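(* Consider the strongest user (user $K$) of the $K$-user cooperative NOMA system, $K\ge2$, with signal-to-interference-plus-noise ratio $$\gamma_K=\frac{|h_K|^2p_K^2}{|h_K|^2\sum_{m=1}^{K-1}p_m^2+\frac1\rho},$$ where $\rho>0$, the coefficients $p_1,\dots,p_K$ are positive, $p_1^2\le\dots\le p_K^2$ and $\sum_{m=1}^Kp_m^2=1$. Then for every threshold $\phi_K\ge 0$ the outage probability of the strongest user is $$\Pr(\gamma_K\le\phi_K)=\begin{cases}\left(1-\exp\left(-\dfrac1\rho\cdot\dfrac{\phi_K}{p_K^2-\phi_K\sum_{m=1}^{K-1}p_m^2}\right)\right)^{K}, & \phi_K<\dfrac{p_K^2}{\sum_{m=1}^{K-1}p_m^2},\\[2mm] 1, & \phi_K\ge\dfrac{p_K^2}{\sum_{m=1}^{K-1}p_m^2}.\end{cases}$$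
   Context: Channel model: $|h_K|^2$ is the maximum of $K$ independent exponential random variables of mean $1$ (the base-station-to-user channel power gains). The number $p_m$ is the power allocation coefficient of user $m$'s message at the base station; the noise has unit variance and $\rho$ is the transmit power. *)

(* Defs.v *)
From HB Require Import structures.
From mathcomp Require Import all_boot all_order all_algebra finmap.
From mathcomp Require Import all_classical all_reals all_analysis.

Set Implicit Arguments.
Unset Strict Implicit.
Unset Printing Implicit Defensive.
Import Order.TTheory GRing.Theory Num.Theory.

Local Open Scope classical_set_scope.
Local Open Scope ring_scope.

(* Mutual independence of the subfamily (X i), i in D: the product rule holds
   for every finite set of indices contained in D. *)
Definition mutually_independent (d : measure_display) (T : measurableType d)
    (R : realType) (P : probability T R) (I : choiceType) (D : set I)
    (X : I -> {RV P >-> R}) : Prop :=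
  forall (J : {fset I}) (A : I -> set R),
    [set` J] `<=` D -> (forall i, measurable (A i)) ->
    P (\bigcap_(i in [set` J]) (X i @^-1` A i)) =
    (\prod_(i <- J) P (X i @^-1` A i))%E.

(* The library's exponential law is parametrized by the rate, i.e. the inverse
   of the mean, and a law is determined by its values on measurable sets. *)
Definition exponential_of_mean (d : measure_display) (T : measurableType d)
    (R : realType) (P : probability T R) (mean : R) (X : {RV P >-> R}) : Prop :=
  forall A : set R, measurable A ->
    distribution P X A = exponential_prob mean^-1 A.

(* Users are numbered 1, ..., K, so the families below are indexed by nat and
   only their values at 1, ..., K matter. *)

(* |h_K|^2 = max (g 1, ..., g K); for K >= 1 the initial value g 1 of the
   iterated maximum is one of the terms. *)
Definition strongest_gain (T : Type) (R : realType) (K : nat)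
    (g : nat -> T -> R) (w : T) : R :=
  \big[Num.max/g 1%N w]_(1 <= k < K.+1) g k w.

Definition interference (R : realType) (K : nat) (p : nat -> R) : R :=
  \sum_(1 <= m < K) p m ^+ 2.

Definition sinr_strongest (T : Type) (R : realType) (K : nat) (rho : R)
    (p : nat -> R) (g : nat -> T -> R) (w : T) : R :=
  strongest_gain K g w * p K ^+ 2 /
  (strongest_gain K g w * interference K p + 1 / rho).

(* Main.v *)
Require Import Defs.
From HB Require Import structures.
From mathcomp Require Import all_boot all_order all_algebra finmap.
From mathcomp Require Import all_classical all_reals all_analysis.
From mathcomp Require Import measurable_realfun lra.
Set Implicit Arguments.
Unset Strict Implicit.
Unset Printing Implicit Defensive.
Import Order.TTheory GRing.Theory Num.Theory.
Local Open Scope classical_set_scope.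
Local Open Scope ring_scope.

(* Outside the null event [g 1 < 0] the strongest gain G is nonnegative, so the
   denominator of the ratio is positive and the outage event is the linear
   condition G * (p_K^2 - phi * interference) <= phi / rho. This always holds
   when the bracket is not positive; otherwise it says that each of the K
   independent gains is at most phi / (rho * (p_K^2 - phi * interference)). *)

Lemma exponential_prob_itvNy0 (R : realType) (r : R) :
  exponential_prob r `]-oo, 0[ = 0%E.
Proof.
by apply: integral0_eq => x; rewrite /= in_itv /= => x0;
  rewrite lt0_exponential_pdf.
Qed.

Lemma exponential_prob_itv0c_ge0 (R : realType) (r x : R) : 0 <= x ->
  exponential_prob r `[0, x] = (1 - expR (- (r * x)))%:E.
Proof.
rewrite le_eqVlt => /predU1P[<-|x0].
  by rewrite set_itv1 /exponential_prob integral_set1 mulr0 oppr0 expR0 subrr.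
by rewrite exponential_prob_itv0c// mulNr.
Qed.

(** Splitting the half-line at 0 leaves only [[0, x]], since the density vanishes on the negative
    reals. *)
Lemma exponential_prob_itvNyc (R : realType) (r x : R) : 0 < r -> 0 <= x ->
  exponential_prob r `]-oo, x] = (1 - expR (- (r * x)))%:E.
Proof.
move=> r0 x0; rewrite -exponential_prob_itv0c_ge0//.
rewrite (@itv_bndbnd_setU _ _ -oo%O (BLeft 0))//.
rewrite /exponential_prob ge0_integral_setU//=.
- by rewrite [X in (X + _)%E](exponential_prob_itvNy0 r) add0e.
- apply: (@measurable_funS _ _ _ _ setT) => //.
  by apply/measurable_EFinP; exact: measurable_exponential_pdf.
- by move=> y _; rewrite lee_fin exponential_pdf_ge0// ltW.
- apply/disj_setPS => y /=; rewrite !in_itv/= => -[y0 /andP[]].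
  by rewrite leNgt y0.
Qed.

(** Clearing the denominator gives a comparison of measurable functions whose direction depends on
    the sign of [h x]. Where [h x] is 0, the quotient is 0 by the convention on inverses, and the
    condition becomes [0 <= r]. *)
Lemma measurable_div_le d (T : measurableType d) (R : realType)
    (f h : T -> R) (r : R) :
  measurable_fun setT f -> measurable_fun setT h ->
  measurable [set x | f x / h x <= r].
Proof.
move=> mf mh.
have mrh : measurable_fun setT (fun x => r * h x).
  by apply: measurable_funM => //; exact: measurable_cst.
have mb : measurable_fun setT (fun x => [|| (0 < h x) && (f x <= r * h x),
    (h x < 0) && (r * h x <= f x) | (h x == 0) && (0 <= r)]).
  apply: measurable_or; last apply: measurable_or; apply: measurable_and => //;
    by [exact: measurable_fun_ltr|exact: measurable_fun_ler
       |exact: measurable_fun_eqr].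
have := mb measurableT [set true] I; rewrite setTI.
congr measurable; apply/seteqP; split=> x /=; case: (ltgtP (h x) 0) => [h0|h0|->];
  rewrite ?invr0 ?mulr0 ?orbF //=.
- by rewrite ler_ndivrMr.
- by rewrite ler_pdivrMr.
- by rewrite ler_ndivrMr.
- by rewrite ler_pdivrMr.
Qed.

(** Adjoining the null set [N] to either set keeps its measure and hides any difference inside [N].
    This allows events to be compared only where the gains are nonnegative. *)
Lemma measure_eqD d (T : ringOfSetsType d) (R : realFieldType)
    (mu : {measure set T -> \bar R}) (A B N : set T) :
  measurable A -> measurable B -> measurable N -> mu N = 0%E ->
  A `\` N = B `\` N -> mu A = mu B.
Proof.
move=> mA mB mN N0 AB.
rewrite -(measureU0 mA mN N0) -(measureU0 mB mN N0).
have UDN C : C `|` N = C `\` N `|` N by rewrite setUDl setDv setD0.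
by rewrite UDN AB -UDN.
Qed.

Lemma strongest_gain_leP (T : Type) (R : realType) (K : nat)
    (g : nat -> T -> R) (w : T) (x : R) : (1 <= K)%N ->
  reflect (forall k, (1 <= k <= K)%N -> g k w <= x)
    (strongest_gain K g w <= x).
Proof.
move=> K1; rewrite /strongest_gain; apply: (iffP idP).
  move=> Gx k kK; apply: le_trans Gx.
  by apply: le_bigmax_seq => //; rewrite mem_index_iota ltnS.
(* The initial value [g 1] of the maximum is bounded by [gx] as well, because [1 <= K]. *)
move=> gx; rewrite big_seq; apply: bigmax_le => [|k]; first exact: gx.
by rewrite mem_index_iota ltnS; exact: gx.
Qed.

Lemma measurable_strongest_gain d (T : measurableType d) (R : realType)
    (K : nat) (g : nat -> T -> R) :
  (forall k, measurable_fun setT (g k)) ->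
  measurable_fun setT (strongest_gain K g).
Proof.
move=> mg; rewrite /strongest_gain.
elim: (index_iota _ _) => [|k s IHs].
  under eq_fun do rewrite big_nil.
  exact: mg.
under eq_fun do rewrite big_cons.
exact: measurable_maxr.
Qed.

Lemma prob_strongest_gain_le (d : measure_display) (T : measurableType d)
    (R : realType) (P : probability T R) (K : nat) (g : nat -> {RV P >-> R}) :
  (1 <= K)%N ->
  (forall k : nat, (1 <= k <= K)%N -> exponential_of_mean 1 (g k)) ->
  mutually_independent [set k : nat | (1 <= k <= K)%N] g ->
  forall x : R, 0 <= x ->
  P [set w | strongest_gain K g w <= x] = ((1 - expR (- x)) ^+ K)%:E.
Proof.
move=> K1 g_exp g_indep x x0.
(* Independence is applied to the finite set of all users; it has exactly [K] elements because
   [iota] has no duplicates, whence the exponent. *)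
pose J := [fset k in iota 1 K]%fset.
have JE k : (k \in J) = (1 <= k <= K)%N by rewrite !inE mem_iota add1n ltnS.
rewrite (_ : mkset _ = \bigcap_(k in [set` J]) (g k @^-1` `]-oo, x])).
  rewrite g_indep => [|k /=|_]; [|by rewrite JE|exact: measurable_itv].
  rewrite big_seq (eq_bigr (fun=> (1 - expR (- x))%:E)) => [|k]; last first.
    rewrite JE => kK; rewrite -[LHS]/(distribution P (g k) `]-oo, x]) g_exp//.
    by rewrite invr1 exponential_prob_itvNyc// mul1r.
  rewrite -big_seq prodEFin big_const_seq iter_mulr_1.
  by rewrite count_predT card_fseq undup_id ?iota_uniq// size_iota.
apply/seteqP; split=> w /=.
  by move=> /(strongest_gain_leP _ _ _ K1) H k /=; rewrite JE in_itv; exact: H.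
move=> H; apply/(strongest_gain_leP _ _ _ K1) => k kK.
by have := H k; rewrite /= JE in_itv; exact.
Qed.

Theorem mainTheorem4 (d : measure_display) (T : measurableType d)
    (R : realType) (P : probability T R)
    (K : nat) (hK : (2 <= K)%N)
    (g : nat -> {RV P >-> R})
    (g_exp : forall k : nat, (1 <= k <= K)%N -> exponential_of_mean 1 (g k))
    (g_indep : mutually_independent [set k : nat | (1 <= k <= K)%N] g)
    (rho : R) (rho_gt0 : 0 < rho)
    (p : nat -> R)
    (p_gt0 : forall m : nat, (1 <= m <= K)%N -> 0 < p m)
    (p_le : forall m n : nat, (1 <= m)%N -> (m <= n)%N -> (n <= K)%N ->
      p m ^+ 2 <= p n ^+ 2)
    (p_sum : \sum_(1 <= m < K.+1) p m ^+ 2 = 1)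
    (phi : R) (phi_ge0 : 0 <= phi) :
  P [set w | sinr_strongest K rho p g w <= phi] =
  (if phi < p K ^+ 2 / interference K p
   then (1 - expR (- (1 / rho * (phi / (p K ^+ 2 - phi * interference K p)))))
          ^+ K
   else 1)%:E.
Proof.
have K1 : (1 <= K)%N by exact: ltnW.
have mG : measurable_fun setT (strongest_gain K g).
  by apply: measurable_strongest_gain => k; exact: measurable_funPT.
have mS : measurable [set w | sinr_strongest K rho p g w <= phi].
  apply: measurable_div_le; first exact: measurable_funM.
  by apply: measurable_funD => //; exact: measurable_funM.
(* One user is enough: the maximum dominates [g 1], so it can be negative only on [N]. *)
set N := g 1%N @^-1` `]-oo, 0[.
have mN : measurable N.
  by rewrite -[N]setTI; apply: measurable_funPT => //; exact: measurable_itv.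
have N0 : P N = 0%E.
  by have := g_exp 1%N K1 _ (measurable_itv `]-oo, 0[); rewrite invr1
    exponential_prob_itvNy0.
have G_ge0 w : ~ N w -> 0 <= strongest_gain K g w.
  rewrite /N /= in_itv /= => /negP; rewrite -leNgt => /le_trans; apply.
  by move/(strongest_gain_leP _ _ _ K1): (lexx (strongest_gain K g w)); apply.
(* Since [2 <= K], the sum contains the positive term of index 1. *)
have I_gt0 : 0 < interference K p.
  rewrite /interference big_ltn// ltr_wpDr ?exprn_gt0 ?p_gt0//.
  by apply: sumr_ge0 => m _; exact: sqr_ge0.
have rhoV_gt0 : 0 < 1 / rho by rewrite divr_gt0.
have outageE w : ~ N w -> (sinr_strongest K rho p g w <= phi) =
    (strongest_gain K g w * (p K ^+ 2 - phi * interference K p)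
     <= 1 / rho * phi).
  move=> /G_ge0 G0; rewrite /sinr_strongest ler_pdivrMr; last first.
    by rewrite ltr_wpDl// mulr_ge0// ltW.
  (* After clearing the denominator, both inequalities differ only by moving the term
     [phi * (G * interference)] across, with G the strongest gain. *)
  apply/idP/idP; lra.
(* The case condition becomes the sign of [p K ^+ 2 - phi * interference K p]. *)
rewrite ltr_pdivlMr//; case: ltP => phiI.
  have a_gt0 : 0 < p K ^+ 2 - phi * interference K p by rewrite subr_gt0.
  (* Reading the closed form backwards as the probability of a threshold event for the strongest
     gain leaves two events to compare off [N]. *)
  rewrite -(@prob_strongest_gain_le _ _ _ P K g)//; last first.
    by rewrite mulr_ge0 ?divr_ge0// ltW.
  apply: (measure_eqD mS _ mN N0).
    rewrite (_ : mkset _ = setT `&` strongest_gain K g @^-1` `]-oo,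
        1 / rho * (phi / (p K ^+ 2 - phi * interference K p))]).
      by apply: mG => //; exact: measurable_itv.
    by rewrite setTI; apply/seteqP; split=> w; rewrite /= in_itv.
  by apply/seteqP; split=> w [/= + Nw]; rewrite outageE// mulrA ler_pdivlMr//=;
    split=> //=; rewrite outageE.
(* Here the bracket is at most 0, so off [N] the left side of the linear condition is at most 0 and
   the right side at least 0: outage is almost sure. *)
rewrite -(probability_setT P).
apply: (measure_eqD mS _ mN N0) => //.
apply/seteqP; split=> w [/= _ Nw]; split=> //=.
rewrite outageE//; apply: le_trans (mulr_ge0 (ltW rhoV_gt0) phi_ge0).
by rewrite mulr_ge0_le0 ?G_ge0// subr_le0.
Qed.
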